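(* The standard domain $(\mathbf{Euc},\mathbb{R})$ supports generalized gradient-based optimization, and for every ordered commutative ring $r$ the $r$-polynomial domain $(\mathbf{Poly}_r, 1)$ supports generalized gradient-based optimization. That is, in each of these domains, every generalized gradient flow $(l, -R[l]_1, s, \tau)$ is a $1$-descending flow: $D_1[l\circ s](t)\le 0$ for all $t\in\tau$.
   Context: Standard domain $(\mathbf{Euc},\mathbb{R})$: $\mathbf{Euc}$ is the category of Euclidean spaces $\mathbb{R}^n$ and infinitely differentiable maps, with Cartesian reverse derivative $R[f](x,x') = J_f(x)^T x'$ and Cartesian derivative $D[f](x,x')=J_f(x)x'$, where $J_f$ is the Jacobian. Objectives are smooth maps $l:\mathbb{R}^n\to\mathbb{R}$; the generalized gradient is $R[l]_1(x) = R[l](x,1)=\nabla l(x)$; for a smooth $f:\mathbb{R}\to\mathbb{R}^n$, $D_1[f](t)=D[f](t,1)=f'(t)$. $r$-polynomial domain $(\mathbf{Poly}_r,1)$, for $r$ an ordered commutative ring (totally ordered): $\mathbf{Poly}_r$ has natural numbers as objects and morphisms $n\to m$ are $m$-tuples of polynomials in $n$ variables with coefficients in $r$; the terminal object is $0$, so morphisms $0\to n$ are elements of $r^n$. The reverse derivative of $P=(p_1,\dots,p_m): n \to m$ is $R[P](x,x')=\left(\sum_{i}\frac{\partial p_i}{\partial x_1}(x)x'_i,\dots,\sum_i\frac{\partial p_i}{\partial x_n}(x)x'_i\right)$ with formal partial derivatives. Objectives are polynomials $l: n\to 1$; the generalized gradient is $R[l]_1(x)=R[l](x,1)=\left(\frac{\partial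 l}{\partial x_1}(x),\dots,\frac{\partial l}{\partial x_n}(x)\right)$; for a tuple $f: 1\to n$ of one-variable polynomials, $D_1[f]$ is the tuple of formal derivatives. In either domain (with $K=\mathbb{R}$ or $K=r$ respectively), a generalized gradient flow $(l,-R[l]_1,s,\tau)$ consists of an objective $l$ in $n$ variables, a morphism $s$ from the one-dimensional object to the $n$-dimensional object (a smooth map $\mathbb{R}\to\mathbb{R}^n$, respectively an $n$-tuple of polynomials in one variable over $r$), and an interval $\tau\subseteq K$ such that $-R[l]_1(s(t)) = D_1[s](t)$ for all $t\in\tau$. It is $1$-descending if $D_1[l\circ s](t)\le 0$ for all $t\in\tau$. An optimization domain supports generalized gradient-based optimization if every generalized gradient flow over it is $1$-descending. *)

(* Defs.v *)
From HB Require Import structures.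
From mathcomp Require Import all_boot all_order all_algebra.
From mathcomp Require Import mathcomp_extra boolp classical_sets functions.
From mathcomp Require Import reals topology normedtype landau derive.
From mathcomp.multinomials Require mpoly.

Set Implicit Arguments.
Unset Strict Implicit.
Unset Printing Implicit Defensive.

Import Order.TTheory GRing.Theory Num.Theory.
Import numFieldNormedType.Exports.

Local Open Scope classical_set_scope.
Local Open Scope ring_scope.

(* Totally ordered commutative rings. MathComp's realDomainType is too
   restrictive: it forces integrality, whereas a totally ordered commutative
   ring may have nilpotents, e.g. the dual numbers with the lexicographic
   order. *)
Record ordComRing := OrdComRing {
  ocr_sort :> comNzRingType;
  ocr_le : rel ocr_sort;
  ocr_le_refl : reflexive ocr_le;
  ocr_le_anti : antisymmetric ocr_le;
  ocr_le_trans : transitive ocr_le;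
  ocr_le_total : total ocr_le;
  ocr_leD2r : forall z x y, ocr_le x y -> ocr_le (x + z) (y + z);
  ocr_mul_ge0 : forall x y, ocr_le 0 x -> ocr_le 0 y -> ocr_le 0 (x * y)
}.

Definition ocr_interval (K : ordComRing) (E : set K) :=
  forall x y, E x -> E y -> forall z, ocr_le x z -> ocr_le z y -> E z.

(* The data of a concrete optimization domain on which the notion of flow
   depends. Objects are natural numbers n, with underlying set of points K^n
   ('rV[K]_n); [od_rdiff f x x'] is R[f](x, x') and [od_diff f x x'] is
   D[f](x, x'), both given by their values at points. The one-dimensional
   object is 1, and a scalar t is identified with the point const_mx t. *)
Record optDomain := OptDomain {
  od_scal : ordComRing;
  od_hom : nat -> nat -> Type;
  od_app : forall n m, od_hom n m -> 'rV[od_scal]_n -> 'rV[od_scal]_m;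
  od_comp : forall n m p, od_hom m p -> od_hom n m -> od_hom n p;
  od_rdiff : forall n m,
    od_hom n m -> 'rV[od_scal]_n -> 'rV[od_scal]_m -> 'rV[od_scal]_n;
  od_diff : forall n m,
    od_hom n m -> 'rV[od_scal]_n -> 'rV[od_scal]_n -> 'rV[od_scal]_m
}.

Section Flows.
Variable C : optDomain.
Local Notation K := (od_scal C).

Definition gen_gradient n (l : od_hom C n 1) (x : 'rV[K]_n) : 'rV[K]_n :=
  od_rdiff l x (const_mx 1).

Definition diff1 n (f : od_hom C 1 n) (t : K) : 'rV[K]_n :=
  od_diff f (const_mx t) (const_mx 1).

Record gradient_flow := GradientFlow {
  flow_dim : nat;
  flow_obj : od_hom C flow_dim 1;
  flow_traj : od_hom C 1 flow_dim;
  flow_time : set K;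
  flow_time_interval : ocr_interval flow_time;
  flow_eq : forall t, flow_time t ->
    - gen_gradient flow_obj (od_app flow_traj (const_mx t))
    = diff1 flow_traj t
}.

Definition one_descending (phi : gradient_flow) :=
  forall t, flow_time phi t ->
    ocr_le (diff1 (od_comp (flow_obj phi) (flow_traj phi)) t 0 0) 0.

Definition supports_gradient_optimization :=
  forall phi : gradient_flow, one_descending phi.

End Flows.

Section Smooth.
Variable R : realType.

(* Class C^k: f is C^(k+1) when it is Frechet differentiable everywhere and all
   its directional derivatives are C^k. *)
Fixpoint Cdiff (k : nat) (V W : normedModType R) (f : V -> W) : Prop :=
  if k is k'.+1
  then (forall x, differentiable f x) /\ (forall v, Cdiff k' ('D_v f))
  else continuous f.

Definition smooth (V W : normedModType R) (f : V -> W) :=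
  forall k, Cdiff k f.

Lemma CdiffW k (V W : normedModType R) (f : V -> W) :
  Cdiff k.+1 f -> Cdiff k f.
Proof.
elim: k W f => [|k IH] W f [df Df] /=.
  by move=> x; apply: differentiable_continuous.
by split=> // v; apply: IH.
Qed.

Lemma Cdiff_cst k (V W : normedModType R) (w : W) : Cdiff k (cst w : V -> W).
Proof.
elim: k w => [|k IH] w /=; first exact: cst_continuous.
split=> [x|v]; first exact: differentiable_cst.
have -> : 'D_v (cst w : V -> W) = cst 0 by apply/funext=> x; rewrite derive_cst.
exact: IH.
Qed.

Lemma CdiffD k (V W : normedModType R) (f g : V -> W) :
  Cdiff k f -> Cdiff k g -> Cdiff k (f + g).
Proof.
elim: k f g => [|k IH] f g /=.
  by move=> cf cg x; apply: continuousD; [exact: cf|exact: cg].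
move=> [df Df] [dg Dg]; split=> [x|v]; first exact: differentiableD.
have -> : 'D_v (f + g) = 'D_v f + 'D_v g.
  by apply/funext=> x; rewrite deriveD //; apply: diff_derivable.
exact: IH.
Qed.

Lemma Cdiff_sum k n (V W : normedModType R) (f : 'I_n -> V -> W) :
  (forall i, Cdiff k (f i)) -> Cdiff k (fun x => \sum_i f i x).
Proof.
move=> Cf.
have -> : (fun x => \sum_i f i x) = \sum_i f i.
  by apply/funext=> x; rewrite fct_sumE.
apply: (big_ind (fun h => Cdiff k h)) => [|g h|i _]; last exact: Cf.
- exact: Cdiff_cst.
- exact: CdiffD.
Qed.

Lemma CdiffM k (V : normedModType R) (a b : V -> R) :
  Cdiff k a -> Cdiff k b -> Cdiff k (a * b).
Proof.
elim: k a b => [|k IH] a b Ca Cb.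
  by move=> x; apply: continuousM; [exact: Ca|exact: Cb].
have [Ca' Cb'] := (CdiffW Ca, CdiffW Cb).
case: Ca Cb => [da Da] [db Db]; split=> [x|v]; first exact: differentiableM.
have -> : 'D_v (a * b) = a * 'D_v b + b * 'D_v a.
  by apply/funext=> x; rewrite deriveM //; apply: diff_derivable.
exact: (CdiffD (IH _ _ Ca' (Db v)) (IH _ _ Cb' (Da v))).
Qed.

Lemma CdiffZl k (V W : normedModType R) (a : V -> R) (w : W) :
  Cdiff k a -> Cdiff k (fun x => a x *: w).
Proof.
elim: k a => [|k IH] a /=.
  by move=> ca x; apply: cvgZr_tmp; exact: ca.
move=> [da Da]; split=> [x|v]; first exact: differentiableZl.
have -> : 'D_v (fun x => a x *: w) = fun x => 'D_v a x *: w.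
  apply/funext=> x; rewrite deriveE; last exact: differentiableZl.
  by rewrite diffZl //= -deriveE.
exact: IH.
Qed.

Lemma Cdiff_coord k n (V : normedModType R) (f : V -> 'rV[R]_n) i :
  Cdiff k f -> Cdiff k (fun x => f x 0 i : R).
Proof.
elim: k f => [|k IH] f /=.
  move=> cf x.
  apply: (@continuous_comp _ _ _ f (fun M : 'rV[R]_n => M 0 i : R)).
    exact: cf.
  exact: coord_continuous.
move=> [df Df].
have dc x : differentiable (fun y => f y 0 i : R) x.
  by apply: (@differentiable_comp _ _ _ _ f (fun M : 'rV[R]_n => M 0 i : R));
    last exact: differentiable_coord.
split=> // v.
have -> : 'D_v (fun x => f x 0 i : R) = fun x => 'D_v f x 0 i.
  apply/funext=> x; rewrite !deriveE //.
  have lin_coord : linear (fun M : 'rV[R]_n => M 0 i : R).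
    by move=> c A B; rewrite !mxE.
  pose crd := HB.pack_for {linear 'rV[R]_n -> R} (fun M : 'rV[R]_n => M 0 i : R)
    (GRing.isLinear.Build _ _ _ _ _ lin_coord).
  rewrite (@diff_comp _ _ _ _ f crd) //; last exact: differentiable_coord.
  rewrite [LHS]/comp diff_lin //; exact: coord_continuous.
exact: IH.
Qed.

Lemma Cdiff_row k n (V : normedModType R) (f : V -> 'rV[R]_n) :
  (forall i, Cdiff k (fun x => f x 0 i : R)) -> Cdiff k f.
Proof.
move=> Cf.
have -> : f = fun x => \sum_i f x 0 i *: delta_mx 0 i.
  by apply/funext=> x; rewrite -row_sum_delta.
by apply: Cdiff_sum => i; apply: CdiffZl.
Qed.

Lemma Cdiff_comp k n m p (g : 'rV[R]_m -> 'rV[R]_p) (f : 'rV[R]_n -> 'rV[R]_m) :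
  Cdiff k g -> Cdiff k f -> Cdiff k (g \o f).
Proof.
elim: k g f => [|k IH] g f.
  by move=> cg cf x; apply: continuous_comp; [exact: cf|exact: cg].
move=> [dg Dg] Cf; have Cf' := CdiffW Cf; case: Cf => [df Df].
split=> [x|v]; first exact: differentiable_comp.
apply: Cdiff_row => j.
have -> : (fun x => 'D_v (g \o f) x 0 j) = fun x =>
    \sum_i ((fun x => 'D_v f x 0 i) *
            (fun x => ('D_(delta_mx 0 i) g \o f) x 0 j)) x.
  apply/funext=> x; rewrite deriveE; last exact: differentiable_comp.
  rewrite diff_comp //= [in LHS](row_sum_delta ('d f x v)) linear_sum summxE.
  apply: eq_bigr => i _.
  by rewrite linearZ mxE -!deriveE.
apply: Cdiff_sum => i.
have C1 := Cdiff_coord i (Df v).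
have C2 := Cdiff_coord j (IH _ _ (Dg (delta_mx 0 i)) Cf').
exact: (CdiffM C1 C2).
Qed.

End Smooth.

Section Euc.
Variable R : realType.

Definition real_ordComRing : ordComRing.
Proof.
apply: (@OrdComRing R <=%R).
- exact: le_refl.
- exact: le_anti.
- exact: le_trans.
- exact: le_total.
- by move=> z x y; rewrite lerD2r.
- exact: mulr_ge0.
Defined.

Record euc_hom (n m : nat) := EucHom {
  euc_fun :> 'rV[R]_n -> 'rV[R]_m;
  euc_smooth : smooth euc_fun
}.

Definition euc_comp n m p (g : euc_hom m p) (f : euc_hom n m) : euc_hom n p :=
  EucHom (fun k => Cdiff_comp (euc_smooth g k) (euc_smooth f k)).

(* Vectors are rows, so MathComp-Analysis' 'J f x acts on the right: it is the
   transpose of the usual (column-convention) Jacobian matrix. Hence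
   J_f(x)^T x' reads x' *m ('J f x)^T and J_f(x) v reads v *m 'J f x. *)
Definition euc_rdiff n m (f : euc_hom n m) (x : 'rV[R]_n) (x' : 'rV[R]_m) :
  'rV[R]_n := x' *m ('J f x)^T.

Definition euc_diff n m (f : euc_hom n m) (x v : 'rV[R]_n) : 'rV[R]_m :=
  v *m 'J f x.

Definition Euc : optDomain :=
  @OptDomain real_ordComRing euc_hom euc_fun euc_comp euc_rdiff euc_diff.

End Euc.

Section Poly.
Variable r : ordComRing.

Definition poly_hom (n m : nat) := m.-tuple (mpoly.mpoly n r).

Definition poly_app n m (P : poly_hom n m) (x : 'rV[r]_n) : 'rV[r]_m :=
  \row_i mpoly.meval (x 0) (tnth P i).

Definition poly_comp n m p (Q : poly_hom m p) (P : poly_hom n m) :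
  poly_hom n p := [tuple mpoly.comp_mpoly P (tnth Q i) | i < p].

Definition poly_rdiff n m (P : poly_hom n m) (x : 'rV[r]_n) (x' : 'rV[r]_m) :
  'rV[r]_n :=
  \row_j \sum_i mpoly.meval (x 0) (mpoly.mderiv j (tnth P i)) * x' 0 i.

Definition poly_diff n m (P : poly_hom n m) (x v : 'rV[r]_n) : 'rV[r]_m :=
  \row_i \sum_j mpoly.meval (x 0) (mpoly.mderiv j (tnth P i)) * v 0 j.

Definition Poly : optDomain :=
  @OptDomain r poly_hom poly_app poly_comp poly_rdiff poly_diff.

End Poly.

(* Main.v *)
From mathcomp Require Import all_boot all_order all_algebra.
From mathcomp.multinomials Require mpoly.
Require Import Defs.
From mathcomp Require Import reals.

(** By the chain rule, D_1[l o s](t) is the sum over i of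
    (grad l)_i(s(t)) * s_i'(t).  Along a gradient flow s'(t) = - grad l(s(t)),
    so this is minus a sum of squares, and squares are nonnegative in any
    totally ordered commutative ring. *)

Set Implicit Arguments.
Unset Strict Implicit.
Unset Printing Implicit Defensive.

Import GRing.Theory.
Local Open Scope ring_scope.

Section OrdComRing.
Variable K : ordComRing.
Implicit Types x y : K.

Lemma ocr_oppr_ge0 x : ocr_le x 0 -> ocr_le 0 (- x).
Proof. by move=> /(ocr_leD2r (- x)); rewrite addrN add0r. Qed.

Lemma ocr_oppr_le0 x : ocr_le 0 x -> ocr_le (- x) 0.
Proof. by move=> /(ocr_leD2r (- x)); rewrite addrN add0r. Qed.

(** By totality one of [x] and [- x] is nonnegative, and both have the same square. *)
Lemma ocr_sqr_ge0 x : ocr_le 0 (x * x).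
Proof.
have [x_ge0|x_le0] := orP (ocr_le_total 0 x); first exact: ocr_mul_ge0.
by rewrite -mulrNN; apply: ocr_mul_ge0; apply: ocr_oppr_ge0.
Qed.

Lemma ocr_addr_ge0 x y : ocr_le 0 x -> ocr_le 0 y -> ocr_le 0 (x + y).
Proof.
move=> x_ge0 y_ge0; apply: ocr_le_trans y_ge0 _.
by rewrite -[X in ocr_le X _]add0r; apply: ocr_leD2r.
Qed.

Lemma ocr_sum_sqr_ge0 n (x : 'I_n -> K) : ocr_le 0 (\sum_i x i * x i).
Proof.
apply: (big_ind (ocr_le 0)) => [|y z|i _].
- exact: ocr_le_refl.
- exact: ocr_addr_ge0.
- exact: ocr_sqr_ge0.
Qed.

End OrdComRing.

(** The domain-specific input, stated at points so that one order-theoretic argument serves both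
    domains. *)
Definition gradient_chain_rule (C : optDomain) :=
  forall n (l : od_hom C n 1) (s : od_hom C 1 n) (t : od_scal C),
    diff1 (od_comp l s) t 0 0 =
    \sum_i gen_gradient l (od_app s (const_mx t)) 0 i * diff1 s t 0 i.

Lemma gradient_chain_rule_supports (C : optDomain) :
  gradient_chain_rule C -> supports_gradient_optimization C.
Proof.
move=> chain [n l s tau /= tau_itv flow] t /= tau_t.
rewrite chain -flow //.
under eq_bigr => i _ do rewrite mxE mulrN.
by rewrite sumrN; apply: ocr_oppr_le0; apply: ocr_sum_sqr_ge0.
Qed.

Module PolyChainRule.
Import mpoly.

(** The polynomials [p] satisfying the identity include constants and variables and are closed under
    sums and, by the Leibniz rule, under products; hence they are all polynomials. *)
Lemma mderiv_comp_mpoly (R : comNzRingType) n k (q : n.-tuple {mpoly R[k]}) j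
    (p : {mpoly R[n]}) :
  mderiv j (p \mPo q) = \sum_i (mderiv i p \mPo q) * mderiv j (tnth q i).
Proof.
pose P p := mderiv j (p \mPo q) =
            \sum_i (mderiv i p \mPo q) * mderiv j (tnth q i).
have PC c : P c%:MP.
  rewrite /P comp_mpolyC mderivC big1 // => i _.
  by rewrite mderivC comp_mpoly0 mul0r.
have PD p1 p2 : P p1 -> P p2 -> P (p1 + p2).
  move=> P1 P2; rewrite /P comp_mpolyD mderivD P1 P2 -big_split /=.
  by apply: eq_bigr => i _; rewrite mderivD comp_mpolyD mulrDl.
have PM p1 p2 : P p1 -> P p2 -> P (p1 * p2).
  move=> P1 P2; rewrite /P rmorphM mderivM P1 P2.
  rewrite mulr_suml mulr_sumr -big_split /=.
  apply: eq_bigr => i _; rewrite mderivM comp_mpolyD !rmorphM mulrDl.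
  by congr (_ + _); rewrite ?mulrA // mulrAC.
have PX i : P 'X_i.
  rewrite /P comp_mpolyXU -tnth_nth (bigD1 i) //= big1 => [|i' ne_i'i].
    (* Subtraction of exponents is truncated, so the leading exponent is padded to a sum with 0
       before cancelling. *)
    rewrite mderivX mnm1E eqxx -[X in (X - _)%MM]add0m addmK /= mpolyX0 scale1r.
    by rewrite comp_mpoly1 mul1r addr0.
  by rewrite mderivX mnm1E eq_sym (negPf ne_i'i) scale0r comp_mpoly0 mul0r.
have P1 : P 1 by rewrite -mpolyC1; apply: PC.
elim/mpolyind: p => [|c m p _ _ Pp]; first by rewrite -mpolyC0; apply: PC.
apply: (PD _ _ _ Pp); rewrite -mul_mpolyC; apply: (PM _ _ (PC c)).
(* The monomial is a product of powers of variables, each handled by induction on its exponent. *)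
rewrite mpolyXE_id; apply: (big_ind P) => // i _.
elim: (m i) => [|d Pd]; first by rewrite expr0.
by rewrite exprS; apply: PM.
Qed.

Lemma poly_gradient_chain_rule (r : ordComRing) : gradient_chain_rule (Poly r).
Proof.
move=> n l s t; rewrite /diff1 /gen_gradient /= /poly_diff /poly_rdiff.
rewrite !mxE big_ord1 mxE mulr1 tnth_mktuple mderiv_comp_mpoly raddf_sum /=.
apply: eq_bigr => i _; rewrite !mxE !big_ord1 !mxE !mulr1 mevalM.
(* Evaluating the composite at t means evaluating the outer polynomial at s(t). *)
congr (_ * _); rewrite comp_mpoly_meval.
by apply: meval_eq => i'; rewrite mxE.
Qed.

End PolyChainRule.

From mathcomp Require Import topology normedtype derive.
Import numFieldNormedType.Exports.

(** Row i of a Jacobian is the differential at the i-th basis row vector, so this is the chain rule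
    for differentials; acting on rows puts the inner map's factor first. *)
Lemma jacobian_comp (R : realType) n m p
    (g : 'rV[R]_m -> 'rV[R]_p) (f : 'rV[R]_n -> 'rV[R]_m) (x : 'rV[R]_n) :
  differentiable f x -> differentiable g (f x) ->
  jacobian (g \o f) x = jacobian f x *m jacobian g (f x).
Proof.
move=> df dg; apply/row_matrixP => i.
by rewrite !rowE mulmxA /jacobian !mul_rV_lin1 diff_comp.
Qed.

Lemma euc_gradient_chain_rule (R : realType) : gradient_chain_rule (Euc R).
Proof.
move=> n l s t; rewrite /diff1 /gen_gradient /= /euc_diff /euc_rdiff.
have [ds _] := euc_smooth s 1; have [dl _] := euc_smooth l 1.
rewrite jacobian_comp // mulmxA mxE; apply: eq_bigr => i _.
(* As [l] is scalar-valued, its Jacobian is a column, whose transpose is the gradient. *)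
by rewrite mulrC; congr (_ * _); rewrite [RHS]mxE big_ord1 !mxE mul1r.
Qed.

Theorem mainTheorem3 :
  (forall R : realType, supports_gradient_optimization (Euc R)) /\
  (forall r : ordComRing, supports_gradient_optimization (Poly r)).
Proof.
split=> [R|r]; apply: gradient_chain_rule_supports.
- exact: euc_gradient_chain_rule.
- exact: PolyChainRule.poly_gradient_chain_rule.
Qed.
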